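(* Let $\mathcal{F}$ be a family of subsets of $[n]$. Assume that there are no 4 different sets $A,B,C,D\in\mathcal{F}$ such that $A\subset B\subset D$, $A\subset C$ and $|B|=|C|$. Then $|\mathcal{F}|\le\Sigma(n,2)$.
   Context: $[n]=\{1,2,\dots,n\}$. For integers $n,k$, $\Sigma(n,k)=\sum_{i=\lceil\frac{n-k}{2}\rceil}^{\lceil\frac{n+k}{2}\rceil-1}\binom{n}{i}$ denotes the sum of the $k$ largest binomial coefficients $\binom{n}{i}$. *)

(* Defs.v *)
From mathcomp Require Import all_boot.

Set Implicit Arguments.
Unset Strict Implicit.
Unset Printing Implicit Defensive.

(* [uphalf m] is the ceiling of m / 2.  When n < k the lower limit
   ceil((n - k) / 2) is <= 0; the truncated [n - k] replaces it by 0, which only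
   discards the terms 'C(n, i) with i < 0, all equal to zero by convention. *)
Definition Sigma (n k : nat) : nat :=
  \sum_(uphalf (n - k) <= i < uphalf (n + k)) 'C(n, i).

(* Main.v *)
(* For a family G, let w_G(S) be the expected sum of the numbers C(n, |T|) over the
   T in G on a uniformly random maximal chain starting at S. Then w_F of the empty
   set is |F|, and w_F(S) is the average of w_F over the upper covers of S when S is
   not in F. Hence it is enough to bound w_F(A) = C(n, |A|) + w_G(A) for A in F, where
   G consists of the members strictly above A. Replacing the top level of G by its
   shadow does not decrease w_G(A) as long as that level is above the middle, since
   the shadow contains at most one old member of G. Once G lives at or below the
   middle (or on the level just above A), its maximal members contribute at most
   C(n, u + 1), u + 1 being the top level, and the remaining ones, of pairwise
   distinct sizes at most u, together with A itself, at most C(n, u). *)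
Require Import Defs.
From mathcomp Require Import all_boot all_order all_algebra zify.

Set Implicit Arguments.
Unset Strict Implicit.
Unset Printing Implicit Defensive.

Import Order.TTheory GRing.Theory Num.Theory.

(** * Inequalities and identities for binomial coefficients *)

Lemma leq_bin_succ n i : i.*2 < n -> 'C(n, i) <= 'C(n, i.+1).
Proof.
move=> lt_i_n; have := mul_bin_left n i; rewrite -(@leq_pmul2l i.+1) //.
move=> ->; apply: leq_mul => //; lia.
Qed.

Lemma leq_bin_lower n i j : i <= j -> j.*2 <= n.+1 -> 'C(n, i) <= 'C(n, j).
Proof.
elim: j => [|j IHj]; first by rewrite leqn0 => /eqP->.
rewrite leq_eqVlt ltnS => /orP[/eqP-> //|le_ij] le_j_n.
by apply: (leq_trans (IHj le_ij _) (leq_bin_succ _)); lia.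
Qed.

Lemma leq_bin_half n i : 'C(n, i) <= 'C(n, n./2).
Proof.
have [le_in|lt_ni] := leqP i n; last by rewrite bin_small.
have [le_i|lt_i] := leqP i n./2; first by apply: leq_bin_lower; lia.
by rewrite -bin_sub //; apply: leq_bin_lower; lia.
Qed.

Lemma Sigma2E n : Sigma n 2 = 'C(n.+1, n.+1./2).
Proof.
(* For [n = 0] the truncated range keeps a single term; otherwise it has exactly two, which Pascal's
   rule merges. *)
rewrite /Sigma; case: n => [|n]; first by rewrite big_nat1.
have -> : uphalf (n.+1 + 2) = (uphalf (n.+1 - 2)).+2 by lia.
have -> : n.+2./2 = (uphalf (n.+1 - 2)).+1.
  by case: n => // n; lia.
by rewrite big_nat_recr //= big_nat1 binS addnC.
Qed.

Lemma bin_pair_le n i : 'C(n, i) + 'C(n, i.+1) <= Sigma n 2.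
Proof. by rewrite addnC -binS Sigma2E leq_bin_half. Qed.

Lemma leq_bin_inner m i : 0 < i < m -> m <= 'C(m, i).
Proof.
elim: m i => [|m IHm] [|i] //=; rewrite ltnS => lt_im; rewrite binS.
have [eq_im|ne_im] := eqVneq i.+1 m; first by rewrite -eq_im binn binSn.
have Hi : 0 < i.+1 < m by lia.
rewrite -addn1 leq_add ?IHm // bin_gt0; lia.
Qed.

(** Both sides count nested pairs of subsets of sizes [a] and [t] in an [n]-set. *)
Lemma bin_mul_bin n t a : a <= t -> t <= n ->
  'C(n, t) * 'C(t, a) = 'C(n, a) * 'C(n - a, t - a).
Proof.
move=> le_at le_tn.
have := bin_fact le_tn; have := bin_fact le_at; have := bin_fact (leq_trans le_at le_tn).
have := @bin_fact (n - a) (t - a) ltac:(lia).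
have -> : n - a - (t - a) = n - t by lia.
move=> e1 e2 e3 e4; have := fact_gt0 a; have := fact_gt0 (t - a); have := fact_gt0 (n - t).
move=> h1 h2 h3; have h : 0 < a`! * ((t - a)`! * (n - t)`!) by rewrite !muln_gt0 h1 h2 h3.
apply/eqP; rewrite -(eqn_pmul2r h); apply/eqP.
rewrite -{1}e3 in e4; rewrite -{1}e1 -{}e4 in e2.
lia.
Qed.

(* In the family of members lying strictly above a member of F, the hypothesis
   says that a non-maximal member is the only one of its size. *)
Definition lonely n (G : {set {set 'I_n}}) :=
  {in G & G & G, forall B C D : {set 'I_n}, B \proper D -> #|B| = #|C| -> B = C}.

(** * Shadows of the top level *)

Definition shadow n (H : {set {set 'I_n}}) (A : {set 'I_n}) u : {set {set 'I_n}} :=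
  [set T : {set 'I_n} | [&& A \proper T, #|T| == u & [exists D in H, T \subset D]]].

Lemma shadow_remove n (H : {set {set 'I_n}}) (A D : {set 'I_n}) u y :
    #|A| < u -> D \in H -> A \subset D -> #|D| = u.+1 -> y \in D -> y \notin A ->
  D :\ y \in shadow H A u.
Proof.
move=> ltAu DH AD cD yD yA.
have cDy : #|D :\ y| = u by rewrite (cardsD1 y) yD in cD; case: cD.
rewrite inE cDy eqxx properEcard cDy ltAu subsetD1 AD yA /=.
by apply/existsP; exists D; rewrite DH subD1set.
Qed.

Lemma card_covers_le n (H : {set {set 'I_n}}) (T : {set 'I_n}) u :
    {in H, forall D : {set 'I_n}, #|D| = u.+1} -> #|T| = u ->
  #|[set D in H | T \subset D]| <= n - u.
Proof.
move=> cH cT.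
have -> : n - u = #|~: T| by rewrite -cT -[X in X - _](card_ord n) -(cardsC T) addKn.
apply: leq_trans (leq_imset_card (fun x => x |: T) _).
apply/subset_leq_card/subsetP => D; rewrite inE => /andP[DH TD].
have : #|D :\: T| == 1 by rewrite cardsDS // cH // cT subSnn.
case/cards1P => x Dx; apply/imsetP; exists x.
  by have := set11 x; rewrite -Dx !inE => /andP[].
by rewrite -Dx -{1}(setID D T) (setIidPr TD) setUC.
Qed.

(* Count the pairs T < D with D in H and T in the shadow. The shadow meets G in
   at most one set B, and the sets D above B inject into the new shadow sets by
   deleting an element of B outside A, so each new T is charged at most
   (n - u) + 1 <= u + 1 times. *)
Lemma shadow_gain n (G H : {set {set 'I_n}}) (A : {set 'I_n}) u :
    lonely G -> H \subset G -> #|A| < u -> n <= u.*2 ->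
    {in H, forall D : {set 'I_n}, A \subset D /\ #|D| = u.+1} ->
  #|H| * (u.+1 - #|A|) <= #|shadow H A u :\: G| * u.+1.
Proof.
move=> loneG HG ltAu le_nu levH.
have cH : {in H, forall D : {set 'I_n}, #|D| = u.+1} by move=> D /levH[].
set X := shadow H A u :\: G.
pose cov (T : {set 'I_n}) := #|[set D in H | T \subset D]|.
have le1 : #|H| * (u.+1 - #|A|) <= \sum_(T in shadow H A u) cov T.
  rewrite -sum_nat_const.
  have -> : \sum_(T in shadow H A u) cov T =
      \sum_(D in H) #|[set T in shadow H A u | T \subset D]|.
    transitivity (\sum_(T in shadow H A u) \sum_(D in H | T \subset D) 1).
      by apply: eq_bigr => T _; rewrite sum1dep_card.
    rewrite (exchange_big_dep [in H]) /= => [|T D _]; last by case/andP.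
    apply: eq_bigr => D DH; rewrite -sum1dep_card.
    by apply: eq_bigl => T; rewrite DH.
  apply: leq_sum => D DH; have [AD cD] := levH D DH.
  rewrite -{1}cD -cardsDS // -(@card_in_imset _ _ (fun y => D :\ y)).
    apply/subset_leq_card/subsetP => _ /imsetP[y /setDP[yD yA] ->].
    by rewrite inE subD1set andbT; apply: shadow_remove.
  move=> x y; rewrite !inE => /andP[_ xD] /andP[_ yD] /setP/(_ x).
  by rewrite !inE eqxx xD andbT; case: eqP.
apply: (leq_trans le1); rewrite (big_setID G) /= -/X.
have le2 : \sum_(T in X) cov T <= #|X| * (n - u).
  rewrite -sum_nat_const; apply: leq_sum => T; rewrite !inE => /and4P[_ _ /eqP cT _].
  exact: card_covers_le.
have [->|[B]] := set_0Vmem (shadow H A u :&: G).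
  by rewrite big_set0 add0n (leq_trans le2) // leq_mul2l; lia.
rewrite inE => /andP[Bsh BG].
have /and3P[AB /eqP cB /exists_inP[D0 D0H BD0]] : [&& A \proper B, #|B| == u & [exists D in H, B \subset D]].
  by move: Bsh; rewrite inE.
(* [B] and [T] both have size [u], and [B] lies properly below [D0] in [G], so loneliness identifies
   them. *)
have uniqB T : T \in shadow H A u -> T \in G -> T = B.
  rewrite inE => /and3P[_ /eqP cT _] TG; apply/esym.
  apply: (loneG B T D0 BG TG (subsetP HG _ D0H)); last by rewrite cB.
  by rewrite properEcard BD0 cB cH ?leqnn.
have -> : shadow H A u :&: G = [set B].
  apply/setP => T; rewrite in_setI in_set1; apply/andP/eqP => [[]|-> //].
  exact: uniqB.
rewrite big_set1.
have le3 : cov B <= #|X|.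
  have /properP[_ [y yB yA]] := AB.
  rewrite /cov -(@card_in_imset _ _ (fun D => D :\ y)).
    apply/subset_leq_card/subsetP => _ /imsetP[D /setIdP[DH BD] ->].
    have [AD cD] := levH D DH.
    have Dsh := shadow_remove ltAu DH AD cD (subsetP BD y yB) yA.
    rewrite in_setD Dsh andbT; apply/negP => /(uniqB _ Dsh)/setP/(_ y).
    by rewrite !inE eqxx yB.
  move=> D E; rewrite !inE => /andP[_ /subsetP/(_ y yB) yD] /andP[_ /subsetP/(_ y yB) yE] eDE.
  by rewrite -(setD1K yD) eDE setD1K.
apply: (leq_trans (leq_add le3 le2)); rewrite -mulnS leq_mul2l; lia.
Qed.

(** * Weights averaged over maximal chains *)

Open Scope ring_scope.

(* 'C(n, s) / 'C(t, s) equals 'C(n, t) / 'C(n - s, t - s), so this is the expected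
   total of 'C(n, #|T|) over the T in G on a random maximal chain from S up. *)
Definition up_weight n (G : {set {set 'I_n}}) (S : {set 'I_n}) : rat :=
  \sum_(T in G | S \subset T) 'C(n, #|S|)%:R / 'C(#|T|, #|S|)%:R.

(** Exchange of summation: each [T] above [S] contains [#|T| - #|S|] of the covers [x |: S], and
    this factor matches the change of the binomial quotient from [#|S|] to [#|S|.+1]. *)
Lemma up_weight_average n (G : {set {set 'I_n}}) (S : {set 'I_n}) : S \notin G ->
  (n - #|S|)%:R * up_weight G S = \sum_(x in ~: S) up_weight G (x |: S).
Proof.
move=> SG; rewrite /up_weight mulr_sumr.
pose f (T : {set 'I_n}) : rat := 'C(n, #|S|.+1)%:R / 'C(#|T|, #|S|.+1)%:R.
transitivity (\sum_(T in G | S \subset T) \sum_(x in T :\: S) f T).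
  apply: eq_bigr => T /andP[TG ST].
  have ltST : (#|S| < #|T|)%N.
    by apply: proper_card; rewrite properEneq ST (contraNneq _ SG) // => ->.
  rewrite sumr_const cardsDS // /f -[RHS]mulr_natl.
  have e1 := mul_bin_left n #|S|; have e2 := mul_bin_left #|T| #|S|.
  have c1 : (0 < 'C(#|T|, #|S|))%N by rewrite bin_gt0 ltnW.
  have c2 : (0 < 'C(#|T|, #|S|.+1))%N by rewrite bin_gt0.
  rewrite !mulrA -!natrM; apply/eqP; rewrite eqr_div ?pnatr_eq0 -?lt0n //.
  rewrite -!natrM eqr_nat -(eqn_pmul2l (ltn0Sn #|S|)); apply/eqP.
  by rewrite -e1 mulnCA e2; lia.
rewrite (exchange_big_dep [in ~: S]) /= => [|T x _]; last by rewrite !inE => /andP[].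
apply: eq_bigr => x; rewrite inE => xS; apply: eq_big => [T|T _].
  by rewrite subUset sub1set inE xS -!andbA; do 2!bool_congr.
by rewrite /f cardsU1 xS add1n.
Qed.

Lemma up_weight_mem n (G : {set {set 'I_n}}) (A : {set 'I_n}) : A \in G ->
  up_weight G A = 'C(n, #|A|)%:R + up_weight [set T in G | A \proper T] A.
Proof.
move=> AG; rewrite /up_weight (bigD1 A) ?AG //= binn divr1; congr (_ + _).
apply: eq_bigl => T; rewrite !inE properEneq eq_sym.
by case: (T \in G) (A \subset T) (A == T) => [] [] [].
Qed.

(** Induction downwards from the full set: outside [G] a weight is the average of the weights of the
    covers, so only sets of [G] need a bound. *)
Lemma up_weight_le n (G : {set {set 'I_n}}) (A : {set 'I_n}) (K : rat) :
    0 <= K -> (forall S, S \in G -> A \subset S -> up_weight G S <= K) ->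
  up_weight G A <= K.
Proof.
move=> K0; have [m] := ubnP (n - #|A|)%N; elim: m A => // m IHm A lt_m leK.
have [AG|AG] := boolP (A \in G); first exact: leK.
have le_An : (#|A| <= n)%N by rewrite -[leqRHS]card_ord max_card.
have [eq_An|ne_An] := eqVneq #|A| n.
  rewrite /up_weight big_pred0 // => T; apply: contraNF AG => /andP[TG AT].
  suff -> : A = T by [].
  by apply/eqP; rewrite eqEcard AT eq_An -[leqRHS]card_ord max_card.
have pos : 0 < (n - #|A|)%:R :> rat by rewrite ltr0n; lia.
rewrite -(ler_pM2l pos) up_weight_average //.
have -> : (n - #|A|)%:R * K = \sum_(x in ~: A) K.
  by rewrite sumr_const -[RHS]mulr_natl -{1}(card_ord n) -(cardsC A) addKn.
apply: ler_sum => x; rewrite inE => xA; apply: IHm => [|S SG].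
  by rewrite cardsU1 xA; lia.
by rewrite subUset => /andP[_]; apply: leK.
Qed.

(** An LYM-type bound: from a member of an antichain, the only member met going up is itself. *)
Lemma antichain_weight_le n (G : {set {set 'I_n}}) (A : {set 'I_n}) u :
    {in G &, forall B D : {set 'I_n}, B \subset D -> B = D} ->
    {in G, forall T : {set 'I_n}, 'C(n, #|T|) <= 'C(n, u)}%N ->
  up_weight G A <= 'C(n, u)%:R.
Proof.
move=> antiG leG; apply: up_weight_le => [|S SG _]; first exact: ler0n.
rewrite up_weight_mem // /up_weight big_pred0 ?addr0 ?ler_nat ?leG // => T.
apply/negP; rewrite inE -andbA => /and3P[TG ltST ST].
by rewrite (antiG _ _ SG TG ST) properxx in ltST.
Qed.

Lemma up_weightU n (G H : {set {set 'I_n}}) (A : {set 'I_n}) : [disjoint G & H] ->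
  up_weight (G :|: H) A = up_weight G A + up_weight H A.
Proof.
move=> disGH; rewrite /up_weight !big_mkcondr /= -bigU //.
by apply: eq_bigl => T; rewrite !inE.
Qed.

Lemma up_weight_level n (G : {set {set 'I_n}}) (A : {set 'I_n}) l :
    {in G, forall T : {set 'I_n}, A \subset T /\ #|T| = l} ->
  up_weight G A = #|G|%:R * ('C(n, #|A|)%:R / 'C(l, #|A|)%:R).
Proof.
move=> levG; rewrite mulr_natl -sumr_const.
by apply: eq_big => [T|T /andP[/levG[_ ->]]] //; apply: andb_idr => /levG[].
Qed.

(** Induction on [r]: the level [r.+1] holds at most one set, and its weight is at most the
    increment ['C(n, r.+1) - 'C(n, r)]. If [r = #|A|], then [G] is empty. *)
Lemma sparse_weight_le n (G : {set {set 'I_n}}) (A : {set 'I_n}) r :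
    {in G, forall T : {set 'I_n}, (A \proper T) && (#|T| <= r)%N} ->
    {in G &, injective (fun T : {set 'I_n} => #|T|)} ->
    (#|A| <= r)%N -> r = #|A| \/ (r.*2 <= n)%N ->
  'C(n, #|A|)%:R + up_weight G A <= 'C(n, r)%:R.
Proof.
elim: r G => [|r IHr] G levG injG.
  rewrite leqn0 => /eqP-> _; rewrite /up_weight big_pred0 ?addr0 // => T.
  by apply/negP => /andP[/levG/andP[/proper_card ltAT]]; rewrite leqNgt (leq_ltn_trans _ ltAT).
rewrite leq_eqVlt => /orP[/eqP eqA _|leA lerA].
  rewrite -eqA /up_weight big_pred0 ?addr0 // => T.
  by apply/negP => /andP[/levG/andP[/proper_card ltAT]]; rewrite leqNgt -eqA ltAT.
have {}lerA : (r.+1.*2 <= n)%N by lia.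
pose low := [set T in G | #|T| <= r]%N; pose top := [set T in G | #|T| == r.+1].
have defG : G = low :|: top.
  apply/setP => T; rewrite !inE -andb_orr orbC -leq_eqVlt.
  by rewrite andb_idr // => /levG/andP[].
have levlow : {in low, forall T : {set 'I_n}, (A \proper T) && (#|T| <= r)%N}.
  by move=> T; rewrite inE => /andP[/levG/andP[-> _] ->].
have injlow : {in low &, injective (fun T : {set 'I_n} => #|T|)}.
  by move=> S T; rewrite !inE => /andP[SG _] /andP[TG _]; apply: injG.
have IH := IHr _ levlow injlow leA ltac:(lia).
have top1 : (#|top| <= 1)%N.
  rewrite leqNgt; apply/card_gt1P => -[S] [T] [].
  rewrite !inE => /andP[SG /eqP eS] /andP[TG /eqP eT] /eqP; apply; apply: injG => //.
  by rewrite eS.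
rewrite {1}defG up_weightU; last first.
  rewrite disjoint_subset; apply/subsetP => T; rewrite !inE => /andP[_ leT].
  by rewrite negb_and neq_ltn ltnS leT orbT.
rewrite (@up_weight_level _ top _ r.+1) => [|T]; last first.
  by rewrite inE => /andP[/levG/andP[/proper_sub ? _] /eqP].
rewrite addrA; apply: le_trans (lerD IH (_ : _ <= 'C(n, #|A|)%:R / 'C(r.+1, #|A|)%:R)) _.
  by rewrite ler_piMl ?divr_ge0 ?ler0n // (ler_nat _ _ 1).
have e1 := @bin_mul_bin n r.+1 #|A| ltac:(lia) ltac:(lia).
have e2 := mul_bin_left n r.
have g1 := @leq_bin_inner (n - #|A|) (r.+1 - #|A|) ltac:(lia).
have c1 : (0 < 'C(r.+1, #|A|))%N by rewrite bin_gt0; lia.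
have c2 : (0 < 'C(n, r.+1))%N by rewrite bin_gt0; lia.
(* After multiplication by [n - r] the increment becomes [(n - r - r.+1) * 'C(n, r.+1)], whose first
   factor is positive; [e1] and [g1] supply the missing [n - r]. *)
rewrite -lerBrDl ler_pdivrMr ?ltr0n // -natrB; last by apply: leq_bin_succ; lia.
rewrite -natrM ler_nat mulnBl -(@leq_pmul2l (n - r)); last by lia.
apply: (@leq_trans ('C(n, r.+1) * 'C(r.+1, #|A|))).
  by rewrite e1 mulnC leq_pmul2l ?bin_gt0; lia.
rewrite mulnBr !mulnA -e2 -!mulnA -mulnBl leq_pmull //; lia.
Qed.

Lemma lonely_push_down n (G : {set {set 'I_n}}) (A : {set 'I_n}) u :
    lonely G -> (#|A| < u)%N -> (n <= u.*2)%N ->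
    {in G, forall T : {set 'I_n}, (A \proper T) && (#|T| <= u.+1)%N} ->
  exists G' : {set {set 'I_n}},
    [/\ lonely G', {in G', forall T : {set 'I_n}, (A \proper T) && (#|T| <= u)%N}
      & up_weight G A <= up_weight G' A].
Proof.
move=> loneG ltAu le_nu levG.
pose low := [set T in G | #|T| <= u]%N; pose top := [set T in G | #|T| == u.+1].
have topG : top \subset G by apply/subsetP => T; rewrite inE => /andP[].
have levtop : {in top, forall T : {set 'I_n}, A \subset T /\ #|T| = u.+1}.
  by move=> T; rewrite inE => /andP[/levG/andP[/proper_sub ? _] /eqP].
have gain := shadow_gain loneG topG ltAu le_nu levtop.
set sh := shadow top A u in gain.
have levsh T : T \in sh -> A \proper T /\ #|T| = u.
  by rewrite inE => /and3P[-> /eqP-> _].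
have lev' : {in low :|: sh, forall T : {set 'I_n}, (A \proper T) && (#|T| <= u)%N}.
  move=> T; rewrite inE => /orP[|/levsh[-> ->]]; last by rewrite leqnn.
  by rewrite inE => /andP[/levG/andP[-> _]].
exists (low :|: sh); split => //.
  (* [B] and [C] have size below [u], hence are old members; if [D] is a shadow set, an old top set
     [E] containing it replaces it. *)
  move=> B C D BG' CG' DG' ltBD eBC; have /andP[_ leD] := lev' _ DG'.
  have ltBu : (#|B| < u)%N := leq_trans (proper_card ltBD) leD.
  have small T : T \in low :|: sh -> (#|T| < u)%N -> T \in G.
    by rewrite inE => /orP[|/levsh[_ ->]]; rewrite ?ltnn // inE => /andP[].
  have BG := small _ BG' ltBu; have CG : C \in G by apply: small => //; rewrite -eBC.
  move: DG'; rewrite inE => /orP[|].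
    by rewrite inE => /andP[DG _]; apply: loneG ltBD eBC.
  rewrite inE => /and3P[_ _ /exists_inP[E Etop DE]].
  by apply: (loneG B C E) => //; [apply: (subsetP topG)|apply: proper_sub_trans DE].
have -> : low :|: sh = low :|: (sh :\: G).
  apply/setP => T; rewrite !in_setU in_setD; have [TG|//] := boolP (T \in G).
  rewrite orbF; apply: orb_idr => /levsh[_ cT].
  by rewrite inE TG cT leqnn.
have {1}-> : G = low :|: top.
  apply/setP => T; rewrite !inE -andb_orr orbC -leq_eqVlt.
  by rewrite andb_idr // => /levG/andP[].
rewrite !up_weightU; first last.
- rewrite disjoint_subset; apply/subsetP => T; rewrite !inE => /andP[_ leT].
  by rewrite negb_and neq_ltn ltnS leT orbT.
- by rewrite disjoint_subset; apply/subsetP => T; rewrite !inE => /andP[-> _].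
rewrite lerD2l (up_weight_level levtop) (@up_weight_level _ _ _ u) => [|T]; last first.
  by rewrite in_setD => /andP[_ /levsh[/proper_sub ? ?]].
have c1 : (0 < 'C(u.+1, #|A|))%N by rewrite bin_gt0; lia.
have c2 : (0 < 'C(u, #|A|))%N by rewrite bin_gt0; lia.
rewrite !(mulrCA _%:R 'C(n, _)%:R) ler_wpM2l ?ler0n //.
rewrite ler_pdivrMr ?ltr0n // mulrAC ler_pdivlMr ?ltr0n // -!natrM ler_nat.
(* As [u.+1 * 'C(u, a) = (u.+1 - a) * 'C(u.+1, a)] with [a = #|A|], the comparison of weights is
   exactly [gain]. *)
rewrite -(@leq_pmul2l u.+1) // mulnCA mul_bin_down mulnA [leqRHS]mulnA leq_mul2r.
by rewrite [X in (_ <= X)%N]mulnC gain orbT.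
Qed.

(* The maximal members form an antichain, worth at most the largest coefficient;
   the others have distinct sizes. *)
Lemma lonely_low_weight_le n (G : {set {set 'I_n}}) (A : {set 'I_n}) u :
    lonely G -> {in G, forall T : {set 'I_n}, (A \proper T) && (#|T| <= u.+1)%N} ->
    (#|A| <= u)%N -> u = #|A| \/ (u.*2 < n)%N ->
  'C(n, #|A|)%:R + up_weight G A <= ('C(n, u) + 'C(n, u.+1))%:R.
Proof.
move=> loneG levG leAu u_low.
pose N := [set T in G | [exists D in G, T \proper D]].
have NG : N \subset G by apply/subsetP => T; rewrite inE => /andP[].
rewrite -(setID G N) (setIidPr NG).
rewrite up_weightU; last by rewrite -setI_eq0 setDE setICA setICr setI0.
rewrite addrA natrD lerD //.
  apply: sparse_weight_le => //; [|move=> S T|lia].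
    move=> T; rewrite inE => /andP[/levG/andP[-> _] /exists_inP[D /levG/andP[_ leD] /proper_card ltTD]].
    by rewrite -ltnS (leq_trans ltTD).
  rewrite !inE => /andP[SG /exists_inP[D DG ltSD]] /andP[TG _] /= eST.
  exact: loneG ltSD eST.
apply: antichain_weight_le => [S T|T]; rewrite !inE.
  move=> /andP[nS SG] /andP[_ TG] ST; apply/eqP; apply: contraNT nS => neST.
  by rewrite SG; apply/exists_inP; exists T; rewrite ?properEneq ?neST.
case/andP => _ /levG/andP[/proper_card ltAT leT].
case: u_low => [eu|lt_un]; last by apply: leq_bin_lower; lia.
by have -> : #|T| = u.+1 by apply/eqP; rewrite eqn_leq leT eu.
Qed.

Lemma lonely_weight_le n (G : {set {set 'I_n}}) (A : {set 'I_n}) :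
    lonely G -> {in G, forall T : {set 'I_n}, A \proper T} ->
  'C(n, #|A|)%:R + up_weight G A <= (Sigma n 2)%:R.
Proof.
move=> loneG ltG.
have cardn (T : {set 'I_n}) : (#|T| <= n)%N by rewrite -[leqRHS]card_ord max_card.
have [u [leAu levG]] : exists u, (#|A| <= u)%N /\
    {in G, forall T : {set 'I_n}, (A \proper T) && (#|T| <= u.+1)%N}.
  by exists n; split=> // T /ltG->; rewrite leqW.
elim: u G loneG {ltG} leAu levG => [|u IHu] G loneG leAu levG.
  apply: le_trans (lonely_low_weight_le loneG levG leAu _) _; first by left; lia.
  by rewrite ler_nat bin_pair_le.
(* Either the level [u.+2] can be pushed down, or it is already the level just above [A] or low
   enough for the direct bound. *)
have [[ltAu le_nu]|] : (#|A| < u.+1 /\ n <= u.+1.*2)%N \/ (u.+1 = #|A| \/ u.+1.*2 < n)%N.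
- lia.
- have [G' [loneG' levG' leGG']] := lonely_push_down loneG ltAu le_nu levG.
  by apply: le_trans (IHu G' loneG' _ levG'); rewrite ?lerD2l.
- move=> u_low; apply: le_trans (lonely_low_weight_le loneG levG leAu u_low) _.
  by rewrite ler_nat bin_pair_le.
Qed.

Close Scope ring_scope.

Theorem theorem2p18 (n : nat) (F : {set {set 'I_n}}) :
  ~ (exists A B C D : {set 'I_n},
       [/\ [/\ A \in F, B \in F, C \in F & D \in F],
           uniq [:: A; B; C; D],
           (A \subset B) && (B \subset D),
           A \subset C
         & #|B| = #|C|]) ->
  #|F| <= Sigma n 2.
Proof.
move=> noABCD; rewrite -(ler_nat rat).
(* At the empty set every quotient of binomials is 1, so the weight counts members. *)
have -> : (#|F|%:R = up_weight F set0)%R.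
  rewrite /up_weight -sumr_const; apply: eq_big => [T|T _]; first by rewrite sub0set andbT.
  by rewrite cards0 !bin0 divr1.
apply: up_weight_le => [|A AF _]; first exact: ler0n.
rewrite up_weight_mem //; apply: lonely_weight_le => [B C D|T]; last by rewrite inE => /andP[].
rewrite !inE => /andP[BF ltAB] /andP[CF ltAC] /andP[DF ltAD] ltBD eBC.
apply/eqP/negP => /negP neBC; apply: noABCD; exists A, B, C, D; split => //.
(* [C] is not above [B]; it differs from [D] because [#|C| = #|B| < #|D|]. *)
- have neCD : C != D by apply: contraTneq (proper_card ltBD) => <-; rewrite eBC ltnn.
  have neBD : B != D by apply: contraTneq ltBD => ->; rewrite properxx.
  have neA (T : {set 'I_n}) : A \proper T -> A != T by apply: contraTneq => ->; rewrite properxx.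
  by rewrite /= !inE !negb_or !neA // neBC neBD neCD.
- by rewrite !proper_sub.
- exact: proper_sub.
Qed.
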